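(* Let $A$ and $B$ be skew braces. If $A$ and $B$ are isoclinic, then $A$ is trivial if and only if $B$ is trivial.
   Context: A skew brace is a triple $(A,+,\circ)$ where $(A,+)$ and $(A,\circ)$ are groups (neither assumed commutative) with $a\circ(b+c)=a\circ b-a+a\circ c$ for all $a,b,c\in A$. The two groups share the identity $0$. The inverse of $a$ in $(A,\circ)$ is denoted $a'$. Put $\lambda_a(b)=-a+a\circ b$, $a*b=-a+a\circ b-b$, $[a,b]_+=a+b-a-b$. The annihilator is $\operatorname{Ann}(A)=\ker\lambda\cap Z(A,+)\cap Z(A,\circ)$, an ideal of $A$, so that $A/\operatorname{Ann}(A)$ is a skew brace; $\overline{a}$ denotes the class of $a$. The commutator $A'$ of $A$ is the additive subgroup generated by all $[a,b]_+$ and all $a*b$, $a,b\in A$; it is an ideal of $A$ (in particular a sub skew brace). The values $[a,b]_+$ and $a*b$ depend only on the classes of $a,b$ modulo $\operatorname{Ann}(A)$. Skew braces $A$ and $B$ are isoclinic if there is an isoclinism $(\xi,\theta)$, i.e. skew brace isomorphisms $\xi\colon A/\operatorname{Ann}(A)\to B/\operatorname{Ann}(B)$ and $\theta\colon A'\to B'$ such that, whenever $a_1,a_2\in A$ and $b_1,b_2\in B$ satisfy $\xi(\overline{a_i})=\overline{b_i}$ for $i=1,2$, one has $\theta([a_1,a_2]_+)=[b_1,b_2]_+$ and $\theta(a_1*a_2)=b_1*b_2$. A skew brace $A$ is trivial if $a+b=a\circ b$ for all $a,b\in A$. *)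

(* Defs.v *)
From HB Require Import structures.
From mathcomp Require Import all_boot.
From mathcomp Require Import boolp classical_sets.

Set Implicit Arguments.
Unset Strict Implicit.
Unset Printing Implicit Defensive.

Local Open Scope classical_set_scope.
Local Open Scope ring_scope.
Local Open Scope quotient_scope.

Import Algebra.

(* The additive group of a skew brace need not be commutative, so it cannot be a
   zmodType, and MathComp's bare opposite [Algebra.opp] is not available below
   zmodType on a choiceType.  [ChoiceBaseAddUMagma] provides the bare addition
   and zero; the mixin adds the opposite, the laws making this a group, and
   skew distributivity.  The circle operation is that of a [groupType]; its
   identity [1] is proved equal to [0] below ([sb_1E]). *)
HB.mixin Record isSkewBrace A of ChoiceBaseAddUMagma A & Group A := {
  sb_opp : A -> A;
  sb_addA : associative (@add A);
  sb_add0 : left_id 0 (@add A);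
  sb_addN : left_inverse 0 sb_opp (@add A);
  sb_dist : forall a b c : A,
    mul a (b + c) = mul a b + sb_opp a + mul a c
}.

#[short(type="skewBraceType")]
HB.structure Definition SkewBrace :=
  {A of isSkewBrace A & ChoiceBaseAddUMagma A & Group A}.

Declare Scope skew_brace_scope.
Delimit Scope skew_brace_scope with SB.
Notation "a ∘ b" := (@mul _ a%SB b%SB)
  (at level 40, left associativity) : skew_brace_scope.
Notation "a + b" := (@add _ a%SB b%SB) : skew_brace_scope.
Notation "0" := (@zero _) : skew_brace_scope.
Notation "- a" := (sb_opp a%SB) : skew_brace_scope.
Notation "a - b" := (@add _ a%SB (sb_opp b%SB)) : skew_brace_scope.
Local Open Scope skew_brace_scope.

Definition sb_trivial (A : skewBraceType) : Prop :=
  forall a b : A, a + b = a ∘ b.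

Definition sb_iso (A B : skewBraceType) (f : A -> B) : Prop :=
  [/\ bijective f, {morph f : a b / a + b} & {morph f : a b / a ∘ b}].

Section SkewBraceOps.
Variable A : skewBraceType.
Implicit Types (a b c : A) (S : set A).

Definition lam a b : A := - a + a ∘ b.

Definition star a b : A := - a + a ∘ b - b.

Definition add_comm a b : A := a + b - a - b.

Definition add_subgroup S : Prop :=
  S 0 /\ (forall a b, S a -> S b -> S (a - b)).

Definition is_ideal S : Prop :=
  [/\ add_subgroup S,
      forall a x, S x -> S (lam a x),
      forall a x, S x -> S (a + x - a) &
      forall a x, S x -> S (a ∘ x ∘ (a^-1)%g)].

End SkewBraceOps.

Section SkewBraceTheory.
Variable A : skewBraceType.
Implicit Types (a b c x y : A).

Lemma sb_addNK a b : - a + (a + b) = b.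
Proof. by rewrite sb_addA sb_addN sb_add0. Qed.

Lemma sb_addI a : injective (@add A a).
Proof. by move=> b c /(congr1 (add (- a)%SB)); rewrite !sb_addNK. Qed.

Lemma sb_addr0 a : a + 0 = a.
Proof. by apply: (@sb_addI (- a)); rewrite sb_addA sb_addN sb_add0. Qed.

Lemma sb_addrN a : a - a = 0.
Proof. by apply: (@sb_addI (- a)); rewrite sb_addNK sb_addr0. Qed.

Lemma sb_addrK a b : a + b - b = a.
Proof. by rewrite -sb_addA sb_addrN sb_addr0. Qed.

Lemma sb_addrNK a b : a - b + b = a.
Proof. by rewrite -sb_addA sb_addN sb_addr0. Qed.

Lemma sb_addNKr a b : a + (- a + b) = b.
Proof. by rewrite sb_addA sb_addrN sb_add0. Qed.

Lemma sb_addIr b : injective (fun a : A => a + b).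
Proof. by move=> a c /(congr1 (add^~ (- b)%SB)); rewrite !sb_addrK. Qed.

Lemma sb_opp_uniq a b : a + b = 0 -> b = - a.
Proof. by move=> ab0; apply: (@sb_addI a); rewrite sb_addrN. Qed.

Lemma sb_oppK a : - - a = a.
Proof. by apply/esym/sb_opp_uniq; rewrite sb_addN. Qed.

Lemma sb_opp0 : - 0 = 0 :> A.
Proof. by apply/esym/sb_opp_uniq; rewrite sb_add0. Qed.

Lemma sb_oppD a b : - (a + b) = - b - a.
Proof. by apply/esym/sb_opp_uniq; rewrite sb_addA sb_addrK sb_addrN. Qed.

Lemma sb_mul0 a : a ∘ 0 = a.
Proof.
have := sb_dist a 0 0; rewrite sb_add0 -sb_addA -{1}[a ∘ 0]sb_addr0.
by move=> /sb_addI /(congr1 (add a)); rewrite sb_addNKr sb_addr0.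
Qed.

Lemma sb_1E : 1%g = 0 :> A.
Proof. by rewrite -(sb_mul0 1%g) mul1g. Qed.

Lemma sb_0mul a : 0 ∘ a = a.
Proof. by rewrite -sb_1E mul1g. Qed.

Lemma sb_mulE a b : a ∘ b = a + lam a b.
Proof. by rewrite /lam sb_addNKr. Qed.

Lemma lamD a : {morph lam a : b c / b + c}.
Proof. by move=> b c; rewrite /lam sb_dist !sb_addA. Qed.

Lemma lam0 a : lam a 0 = 0.
Proof. by rewrite /lam sb_mul0 sb_addN. Qed.

Lemma lamN a b : lam a (- b) = - lam a b.
Proof. by apply: sb_opp_uniq; rewrite -lamD sb_addrN lam0. Qed.

Lemma lamM a b c : lam (a ∘ b) c = lam a (lam b c).
Proof.
apply: (@sb_addI (a ∘ b)).
have -> : a ∘ b + lam (a ∘ b) c = a ∘ (b ∘ c) by rewrite -sb_mulE mulgA.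
by rewrite (sb_mulE b c) (sb_mulE a (b + _)) lamD sb_addA -(sb_mulE a b).
Qed.

Lemma lam0l b : lam 0 b = b.
Proof. by rewrite /lam sb_0mul sb_opp0 sb_add0. Qed.

Lemma sb_mulV a : a ∘ (a^-1)%g = 0.
Proof. by rewrite mulgV sb_1E. Qed.

Lemma sb_Vmul a : (a^-1)%g ∘ a = 0.
Proof. by rewrite mulVg sb_1E. Qed.

Lemma lamVK a b : lam a (lam (a^-1)%g b) = b.
Proof. by rewrite -lamM sb_mulV lam0l. Qed.

Lemma sb_invE a : (a^-1)%g = - lam (a^-1)%g a.
Proof.
rewrite -[LHS]sb_oppK; congr (- _); apply/esym/sb_opp_uniq.
by rewrite -sb_mulE sb_Vmul.
Qed.

Section SubgroupTheory.
Variables (S : set A) (sgS : add_subgroup S).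

Lemma sg0 : S 0. Proof. exact: sgS.1. Qed.

Lemma sgN a : S a -> S (- a).
Proof. by move=> Sa; rewrite -[- a]sb_add0; apply: sgS.2 => //; exact: sg0. Qed.

Lemma sgD a b : S a -> S b -> S (a + b).
Proof. by move=> Sa Sb; rewrite -[b]sb_oppK; apply: sgS.2 => //; exact: sgN. Qed.

End SubgroupTheory.
End SkewBraceTheory.

Record ideal (A : skewBraceType) := Ideal {
  ideal_set :> A -> Prop;
  idealP : is_ideal ideal_set
}.

Section IdealTheory.
Variables (A : skewBraceType) (I : ideal A).

Lemma ideal_sg : add_subgroup (ideal_set I). Proof. by case: (idealP I). Qed.
Lemma ideal_lam a x : I x -> I (lam a x).
Proof. by case: (idealP I) => _ h _ _; exact: h. Qed.
Lemma ideal_addJ a x : I x -> I (a + x - a).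
Proof. by case: (idealP I) => _ _ h _; exact: h. Qed.
Lemma ideal_mulJ a x : I x -> I (a ∘ x ∘ (a^-1)%g).
Proof. by case: (idealP I) => _ _ _ h; exact: h. Qed.
Lemma ideal0 : I 0. Proof. exact: sg0 ideal_sg. Qed.
Lemma idealD x y : I x -> I y -> I (x + y). Proof. exact: sgD ideal_sg _ _. Qed.
Lemma idealN x : I x -> I (- x). Proof. exact: sgN ideal_sg _. Qed.
Lemma idealM x y : I x -> I y -> I (x ∘ y).
Proof. by move=> Ix Iy; rewrite sb_mulE; apply: idealD => //; exact: ideal_lam. Qed.
Lemma idealV x : I x -> I (x^-1)%g.
Proof. by move=> Ix; rewrite sb_invE; apply: idealN; exact: ideal_lam. Qed.

End IdealTheory.

Section IdealSkewBrace.
Variables (A : skewBraceType) (I : ideal A).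

Definition subIdeal : Type := set_type (ideal_set I).

HB.instance Definition _ := Choice.on subIdeal.
HB.instance Definition _ := SubChoice.on subIdeal.

Implicit Types u v : subIdeal.

Lemma subIdealP u : I (val u). Proof. exact: set_mem (valP u). Qed.

Definition toIdeal (x : A) (Ix : I x) : subIdeal := exist _ x (mem_set Ix).

Lemma val_toIdeal x Ix : val (@toIdeal x Ix) = x. Proof. by []. Qed.

Definition si_zero : subIdeal := toIdeal (ideal0 I).
Definition si_add u v : subIdeal := toIdeal (idealD (subIdealP u) (subIdealP v)).
Definition si_opp u : subIdeal := toIdeal (idealN (subIdealP u)).
Definition si_mul u v : subIdeal := toIdeal (idealM (subIdealP u) (subIdealP v)).
Definition si_inv u : subIdeal := toIdeal (idealV (subIdealP u)).


Lemma si_mulA : associative si_mul.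
Proof. by move=> u v w; apply: val_inj; rewrite /= mulgA. Qed.
Lemma si_mul0 : left_id si_zero si_mul.
Proof. by move=> u; apply: val_inj; rewrite /= sb_0mul. Qed.
Lemma si_mul0r : right_id si_zero si_mul.
Proof. by move=> u; apply: val_inj; rewrite /= sb_mul0. Qed.
Lemma si_mulV : left_inverse si_zero si_inv si_mul.
Proof. by move=> u; apply: val_inj; rewrite /= sb_Vmul. Qed.
Lemma si_mulrV : right_inverse si_zero si_inv si_mul.
Proof. by move=> u; apply: val_inj; rewrite /= sb_mulV. Qed.

HB.instance Definition _ :=
  isGroup.Build subIdeal si_mulA si_mul0 si_mul0r si_mulV si_mulrV.
HB.instance Definition _ := hasAdd.Build subIdeal si_add.
HB.instance Definition _ := hasZero.Build subIdeal si_zero.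

Lemma si_addA : associative si_add.
Proof. by move=> u v w; apply: val_inj; rewrite /= sb_addA. Qed.
Lemma si_add0 : left_id si_zero si_add.
Proof. by move=> u; apply: val_inj; rewrite /= sb_add0. Qed.
Lemma si_addN : left_inverse si_zero si_opp si_add.
Proof. by move=> u; apply: val_inj; rewrite /= sb_addN. Qed.
Lemma si_dist (u v w : subIdeal) : u ∘ (v + w) = u ∘ v + si_opp u + u ∘ w.
Proof. by apply: val_inj; rewrite /= sb_dist. Qed.

HB.instance Definition _ :=
  isSkewBrace.Build subIdeal si_addA si_add0 si_addN si_dist.

End IdealSkewBrace.

Section QuotientSkewBrace.
Variables (A : skewBraceType) (I : ideal A).
Implicit Types x y z : A.

(* For an ideal, the additive cosets a + I and a ∘ I coincide. *)
Definition ideal_rel x y : bool := `[< I (- x + y) >].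

Fact ideal_rel_refl : reflexive ideal_rel.
Proof. by move=> x; apply/asboolP; rewrite sb_addN; exact: ideal0. Qed.

Fact ideal_rel_sym : symmetric ideal_rel.
Proof.
suff h x y : ideal_rel x y -> ideal_rel y x by move=> x y; apply/idP/idP; exact: h.
by move=> /asboolP /idealN; rewrite sb_oppD sb_oppK => ?; apply/asboolP.
Qed.

Fact ideal_rel_trans : transitive ideal_rel.
Proof.
move=> y x z /asboolP xy /asboolP yz; apply/asboolP.
by have := idealD xy yz; rewrite -sb_addA sb_addNKr.
Qed.

Canonical ideal_equiv :=
  EquivRel ideal_rel ideal_rel_refl ideal_rel_sym ideal_rel_trans.

Lemma ideal_relP x y : reflect (exists2 i, I i & y = x + i) (ideal_rel x y).
Proof.
apply: (iffP (asboolP _)) => [h|[i Ii ->]]; last by rewrite sb_addNK.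
by exists (- x + y) => //; rewrite sb_addNKr.
Qed.

Lemma ideal_rel_mulP x y : reflect (exists2 i, I i & y = x ∘ i) (ideal_rel x y).
Proof.
apply: (iffP (ideal_relP _ _)) => -[i Ii ->].
  exists (lam x^-1%g i); first exact: ideal_lam.
  by rewrite sb_mulE lamVK.
by exists (lam x i); [exact: ideal_lam | rewrite sb_mulE].
Qed.

Lemma ideal_rel_add x x' y y' :
  ideal_rel x x' -> ideal_rel y y' -> ideal_rel (x + y) (x' + y').
Proof.
move=> /ideal_relP[i Ii ->] /ideal_relP[j Ij ->]; apply/ideal_relP.
exists (- y + i - - y + j).
  by apply: idealD => //; exact: ideal_addJ.
by rewrite sb_oppK !sb_addA sb_addrK.
Qed.

Lemma ideal_rel_opp x x' : ideal_rel x x' -> ideal_rel (- x) (- x').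
Proof.
move=> /ideal_relP[i Ii ->]; apply/ideal_relP; exists (x - i - x).
  by apply: ideal_addJ; exact: idealN.
by rewrite sb_oppD !sb_addA sb_addN sb_add0.
Qed.

Lemma ideal_rel_mul x x' y y' :
  ideal_rel x x' -> ideal_rel y y' -> ideal_rel (x ∘ y) (x' ∘ y').
Proof.
move=> /ideal_rel_mulP[i Ii ->] /ideal_rel_mulP[j Ij ->]; apply/ideal_rel_mulP.
exists ((y^-1 ∘ i ∘ (y^-1)^-1)%g ∘ j).
  by apply: idealM => //; exact: ideal_mulJ.
by rewrite invgK !mulgA mulgK.
Qed.

Lemma ideal_rel_inv x x' : ideal_rel x x' -> ideal_rel x^-1%g x'^-1%g.
Proof.
move=> /ideal_rel_mulP[i Ii ->]; apply/ideal_rel_mulP.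
exists (x ∘ i^-1%g ∘ x^-1%g); first by apply: ideal_mulJ; exact: idealV.
by rewrite invgM !mulgA mulVg mul1g.
Qed.

Definition quotIdeal : Type := {eq_quot ideal_equiv}.

HB.instance Definition _ := Choice.on quotIdeal.
HB.instance Definition _ := EqQuotient.on quotIdeal.

Definition clsI (x : A) : quotIdeal := \pi x.

Definition qi_add (u v : quotIdeal) : quotIdeal := clsI (repr u + repr v).
Definition qi_opp (u : quotIdeal) : quotIdeal := clsI (- repr u).
Definition qi_mul (u v : quotIdeal) : quotIdeal := clsI (repr u ∘ repr v).
Definition qi_inv (u : quotIdeal) : quotIdeal := clsI (repr u)^-1%g.
Definition qi_zero : quotIdeal := clsI 0.

Lemma clsIP x y : clsI x = clsI y <-> ideal_rel x y.
Proof. by split=> [/eqmodP|h] //; apply/eqmodP. Qed.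

Lemma clsI_surj (u : quotIdeal) : exists x, u = clsI x.
Proof. by exists (repr u); rewrite /clsI reprK. Qed.

Lemma repr_clsI x : ideal_rel (repr (clsI x)) x.
Proof. by apply/clsIP; rewrite /clsI reprK. Qed.

Lemma clsI_add x y : qi_add (clsI x) (clsI y) = clsI (x + y).
Proof. by apply/clsIP/ideal_rel_add; exact: repr_clsI. Qed.
Lemma clsI_opp x : qi_opp (clsI x) = clsI (- x).
Proof. by apply/clsIP/ideal_rel_opp; exact: repr_clsI. Qed.
Lemma clsI_mul x y : qi_mul (clsI x) (clsI y) = clsI (x ∘ y).
Proof. by apply/clsIP/ideal_rel_mul; exact: repr_clsI. Qed.
Lemma clsI_inv x : qi_inv (clsI x) = clsI x^-1%g.
Proof. by apply/clsIP/ideal_rel_inv; exact: repr_clsI. Qed.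

Lemma qi_mulA : associative qi_mul.
Proof.
move=> u v w; have [x ->] := clsI_surj u; have [y ->] := clsI_surj v.
by have [z ->] := clsI_surj w; rewrite !clsI_mul mulgA.
Qed.
Lemma qi_mul0 : left_id qi_zero qi_mul.
Proof. by move=> u; have [x ->] := clsI_surj u; rewrite clsI_mul sb_0mul. Qed.
Lemma qi_mul0r : right_id qi_zero qi_mul.
Proof. by move=> u; have [x ->] := clsI_surj u; rewrite clsI_mul sb_mul0. Qed.
Lemma qi_mulV : left_inverse qi_zero qi_inv qi_mul.
Proof.
by move=> u; have [x ->] := clsI_surj u; rewrite clsI_inv clsI_mul sb_Vmul.
Qed.
Lemma qi_mulrV : right_inverse qi_zero qi_inv qi_mul.
Proof.
by move=> u; have [x ->] := clsI_surj u; rewrite clsI_inv clsI_mul sb_mulV.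
Qed.

HB.instance Definition _ :=
  isGroup.Build quotIdeal qi_mulA qi_mul0 qi_mul0r qi_mulV qi_mulrV.
HB.instance Definition _ := hasAdd.Build quotIdeal qi_add.
HB.instance Definition _ := hasZero.Build quotIdeal qi_zero.

Lemma qi_addA : associative qi_add.
Proof.
move=> u v w; have [x ->] := clsI_surj u; have [y ->] := clsI_surj v.
by have [z ->] := clsI_surj w; rewrite !clsI_add sb_addA.
Qed.
Lemma qi_add0 : left_id qi_zero qi_add.
Proof.
by move=> u; have [x ->] := clsI_surj u; rewrite clsI_add sb_add0.
Qed.
Lemma qi_addN : left_inverse qi_zero qi_opp qi_add.
Proof.
by move=> u; have [x ->] := clsI_surj u; rewrite clsI_opp clsI_add sb_addN.
Qed.
Lemma qi_dist u v w :
  qi_mul u (qi_add v w) = qi_add (qi_add (qi_mul u v) (qi_opp u)) (qi_mul u w).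
Proof.
have [x ->] := clsI_surj u; have [y ->] := clsI_surj v.
have [z ->] := clsI_surj w.
by rewrite clsI_opp clsI_add !clsI_mul !clsI_add sb_dist.
Qed.

HB.instance Definition _ :=
  isSkewBrace.Build quotIdeal qi_addA qi_add0 qi_addN qi_dist.

Lemma clsID : {morph clsI : x y / x + y}.
Proof. by move=> x y; rewrite -clsI_add. Qed.
Lemma clsIM : {morph clsI : x y / x ∘ y}.
Proof. by move=> x y; rewrite -clsI_mul. Qed.
Lemma clsIN : {morph clsI : x / - x}.
Proof. by move=> x; rewrite -clsI_opp. Qed.
Lemma clsI0 : clsI 0 = 0. Proof. by []. Qed.

End QuotientSkewBrace.

Section AnnDer.
Variable A : skewBraceType.
Implicit Types a b x : A.

Definition ker_lam : set A := [set a | lam a =1 id].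
Definition add_center : set A := [set a | forall b, a + b = b + a].
Definition mul_center : set A := [set a | forall b, a ∘ b = b ∘ a].
Definition Ann_set : set A := ker_lam `&` add_center `&` mul_center.

Definition der_gens : set A :=
  [set x | exists a b, x = add_comm a b] `|` [set x | exists a b, x = star a b].
Definition der_set : set A := smallest (@add_subgroup A) der_gens.

Lemma Ann_mulE a b : Ann_set a -> b ∘ a = a + b.
Proof. by move=> [[ka _] ma]; rewrite -ma sb_mulE ka. Qed.

Lemma Ann_mulrE a b : Ann_set a -> b ∘ a = b + a.
Proof. by move=> Aa; rewrite Ann_mulE //; case: Aa => -[_ ->]. Qed.

Lemma Ann_lam a b : Ann_set a -> lam b a = a.
Proof. by move=> Aa; apply: (@sb_addI _ b); rewrite -sb_mulE Ann_mulrE. Qed.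

Lemma Ann_invE a : Ann_set a -> a^-1%g = - a.
Proof. by move=> Aa; rewrite sb_invE Ann_lam. Qed.

Lemma Ann_ideal : is_ideal Ann_set.
Proof.
have AN a : Ann_set a -> Ann_set (- a).
  move=> Aa; have [[ka aa] ma] := Aa; split; first split.
  - by move=> b; rewrite -Ann_invE // -[X in lam _ X]ka -lamM sb_Vmul lam0l.
  - by move=> b; apply: (@sb_addI _ a); rewrite sb_addNKr sb_addA aa sb_addrK.
  - move=> b; rewrite -Ann_invE //; apply: (mulgI a).
    by rewrite mulgA mulgV mul1g mulgA ma -mulgA mulgV mulg1.
have AD a b : Ann_set a -> Ann_set b -> Ann_set (a + b).
  move=> Aa Ab; have [[ka aa] ma] := Aa; have [[kb ab] mb] := Ab.
  split; first split.
  - by move=> c; rewrite -(Ann_mulrE a Ab) lamM kb ka.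
  - by move=> c; rewrite -sb_addA ab sb_addA (aa c) sb_addA.
  - by move=> c; rewrite -(Ann_mulrE a Ab) -mulgA mb mulgA (ma c) mulgA.
split; first split.
- split; first split.
  + by move=> b; rewrite lam0l.
  + by move=> b; rewrite sb_add0 sb_addr0.
  + by move=> b; rewrite sb_0mul sb_mul0.
- by move=> a b Aa Ab; apply: AD => //; exact: AN.
- by move=> a x Ax; rewrite Ann_lam.
- by move=> a x Ax; case: (Ax) => -[_ <-] _; rewrite sb_addrK.
- by move=> a x Ax; case: (Ax) => _ <-; rewrite mulgK.
Qed.

Lemma der_sg : add_subgroup der_set.
Proof.
split=> [S [[S0 _] _] //|a b Da Db S SP].
by have [[_ h] _] := SP; apply: h; [exact: Da | exact: Db].
Qed.

Lemma der_add_comm a b : der_set (add_comm a b).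
Proof. by move=> S [_]; apply; left; exists a, b. Qed.

Lemma der_star a b : der_set (star a b).
Proof. by move=> S [_]; apply; right; exists a, b. Qed.

Lemma der_ideal : is_ideal der_set.
Proof.
have lam_star a b : lam a b = star a b + b by rewrite /star sb_addrNK.
have Dlam a x : der_set x -> der_set (lam a x).
  by move=> Dx; rewrite lam_star; apply: (sgD der_sg) => //; exact: der_star.
have DJ a x : der_set x -> der_set (a + x - a).
  move=> Dx; have -> : a + x - a = add_comm a x + x by rewrite /add_comm sb_addrNK.
  by apply: (sgD der_sg) => //; exact: der_add_comm.
split=> // [|a x Dx]; first exact: der_sg.
set w := a ∘ x ∘ a^-1%g.
have : w + star w a = a + lam a x - a.
  apply: (@sb_addIr _ a); rewrite sb_addrNK -sb_addA -lam_star.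
  by rewrite -(sb_mulE w a) -(sb_mulE a x) /w -mulgA mulVg mulg1.
move=> /(congr1 (add^~ (- star w a)%SB)); rewrite sb_addrK => ->.
by apply: (proj2 der_sg); [exact: (DJ _ _ (Dlam _ _ Dx)) | exact: der_star].
Qed.

Definition Ann : ideal A := Ideal Ann_ideal.
Definition derived : ideal A := Ideal der_ideal.

(* The values [a,b]_+ and a * b as elements of the skew brace A'. *)
Definition der_comm a b : subIdeal derived :=
  @toIdeal A derived (add_comm a b) (der_add_comm a b).
Definition der_st a b : subIdeal derived :=
  @toIdeal A derived (star a b) (der_star a b).

End AnnDer.

Definition isoclinism (A B : skewBraceType)
    (xi : quotIdeal (Ann A) -> quotIdeal (Ann B))
    (theta : subIdeal (derived A) -> subIdeal (derived B)) : Prop :=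
  [/\ sb_iso xi, sb_iso theta &
      forall (a1 a2 : A) (b1 b2 : B),
        xi (clsI (Ann A) a1) = clsI (Ann B) b1 ->
        xi (clsI (Ann A) a2) = clsI (Ann B) b2 ->
        theta (der_comm a1 a2) = der_comm b1 b2 /\
        theta (der_st a1 a2) = der_st b1 b2].

Definition isoclinic (A B : skewBraceType) : Prop :=
  exists xi theta, @isoclinism A B xi theta.

(* Main.v *)
Require Import Defs.
From mathcomp Require Import all_boot.

(** A skew brace is trivial exactly when all its values [a * b] vanish.  An
    isoclinism matches these values through the injective morphism [theta],
    and since [xi] is bijective every pair in one brace has a matching pair in
    the other. *)

Set Implicit Arguments.
Unset Strict Implicit.
Unset Printing Implicit Defensive.

Local Open Scope skew_brace_scope.

Lemma star_eq0 (A : skewBraceType) (a b : A) : star a b = 0 <-> a ∘ b = a + b.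
Proof.
rewrite /star; split=> [/(congr1 (fun x => a + (x + b)))|->].
  by rewrite sb_addrNK sb_addNKr sb_add0.
by rewrite sb_addNK sb_addrN.
Qed.

Lemma sb_trivialP (A : skewBraceType) :
  sb_trivial A <-> forall a b : A, star a b = 0.
Proof.
split=> h a b; first by apply/star_eq0; rewrite h.
by symmetry; apply/star_eq0.
Qed.

(** [sb_iso] does not list [f 0 = 0]; it follows by cancelling in [f 0 + f 0 = f 0], and injectivity
    does the rest. *)
Lemma sb_iso_eq0 (A B : skewBraceType) (f : A -> B) (x : A) :
  sb_iso f -> f x = 0 <-> x = 0.
Proof.
move=> [[g fK _] fD _].
have f0 : f 0 = 0 by apply: (@sb_addI B (f 0)); rewrite -fD !sb_addr0.
by split=> [|->] //; rewrite -f0 => /(can_inj fK).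
Qed.

Lemma der_st_eq0 (A : skewBraceType) (a b : A) :
  der_st a b = 0 <-> star a b = 0.
Proof. by split=> [/(congr1 val)|ab0] //; apply: val_inj. Qed.

(** Both values are read in the derived ideals, where the injective [theta] carries one to the
    other. *)
Lemma isoclinism_star_eq0 (A B : skewBraceType) xi theta
    (a1 a2 : A) (b1 b2 : B) :
  @isoclinism A B xi theta ->
  xi (clsI (Ann A) a1) = clsI (Ann B) b1 ->
  xi (clsI (Ann A) a2) = clsI (Ann B) b2 ->
  star a1 a2 = 0 <-> star b1 b2 = 0.
Proof.
move=> [_ theta_iso match_ab] e1 e2; have [_ e] := match_ab _ _ _ _ e1 e2.
by rewrite -!der_st_eq0 -e (sb_iso_eq0 _ theta_iso).
Qed.

Theorem theorem3p1 (A B : skewBraceType) :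
  isoclinic A B -> (sb_trivial A <-> sb_trivial B).
Proof.
move=> [xi [theta iso]]; have [[[xi' _ xi'K] _ _] _ _] := iso.
rewrite !sb_trivialP; split=> h.
  move=> b1 b2.
  (* [a1] and [a2] represent the preimages under [xi] of the classes of [b1] and [b2]. *)
  have [a1 e1] := clsI_surj (xi' (clsI (Ann B) b1)).
  have [a2 e2] := clsI_surj (xi' (clsI (Ann B) b2)).
  by apply/(@isoclinism_star_eq0 _ _ _ _ a1 a2 _ _ iso); rewrite -?e1 -?e2 ?xi'K.
move=> a1 a2.
have [b1 e1] := clsI_surj (xi (clsI (Ann A) a1)).
have [b2 e2] := clsI_surj (xi (clsI (Ann A) a2)).
by apply/(@isoclinism_star_eq0 _ _ _ _ _ _ b1 b2 iso).
Qed.
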